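(* Given a cyclic $n$-gon of crossing parity $\epsilon$ and radius $r$, let $m=\lfloor (n-1)/2\rfloor$ and let $u_j=r^{2j}\sum_{i=1}^{j-1}\left(\tfrac14 d_i-d_{i-1}\right)d_{j-i}$ for $j\ge 1$. Inductively define $t_0=-2$ and $$t_j=(-1)^{j+1}\sigma_j+\sum_{\substack{1\le i\le m\\ 1\le j-i\le m}}\frac{t_it_{j-i}}{4}+\begin{cases}-u_j,&\text{if } j\le m,\\ \epsilon\cdot(-1)^m\,t_{j-m-1}\sqrt{\sigma_n},&\text{if } j>m,\end{cases}$$ for $j=1,\ldots,2m+1$. Then $t_j=-e_jr^{2j}$ for $0\le j\le m$, and the polynomial $$P_n(z)=u_2+u_3z+\cdots+u_mz^{m-2}+t_{m+1}z^{m-1}+\cdots+t_{2m+1}z^{2m-1}$$ (that is, $P_n(z)=\sum_{j=2}^{m}u_jz^{j-2}+\sum_{j=m+1}^{2m+1}t_jz^{j-2}$) factors as $$P_n(z)=\left(\tfrac14-r^2z\right)\left[z^{-1}D(r^2z)\right]^2 .$$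
   Context: A cyclic $n$-gon ($n\ge3$) is a (possibly non-convex, self-intersecting) $n$-gon inscribed in a circle; here the circle has radius $r$ and center $0$ in $\mathbb{C}$, the vertices are $v_1,\dots,v_n$ with $|v_i|=r$, and $v_{n+1}=v_1$. All edges have positive length. The side lengths are $a_i=|v_{i+1}-v_i|$, and $\sigma_0=1,\sigma_1,\dots,\sigma_n$ are the elementary symmetric functions of $a_1^2,\dots,a_n^2$; $\sqrt{\sigma_n}=a_1\cdots a_n$. The vertex quotients are $q_i=v_{i+1}/v_i$ for $1\le i\le n$, and $\tau_0=1,\tau_1,\dots,\tau_n$ are their elementary symmetric functions (so $\tau_n=1$). Crossing parity: for odd $n$ put $\epsilon=0$; for even $n$ let $\epsilon=\pm1$ be the sign of the nonzero real number $(1-q_1)(1-q_2)\cdots(1-q_n)$. For integers $0\le k\le n/2$ define $$d_k=\sum_{i=0}^k(-1)^i\binom{n-1-2k+i}{i}(\tau_{k-i}-\tau_{n-k+i}),$$ $$e_k=\sum_{i=0}^k(-1)^i\left[\binom{n-2k+i}{i}+\binom{n-2k+i-1}{i-1}\right](\tau_{k-i}+\tau_{n-k+i}),$$ where $\binom{a}{0}=1$ and $\binom{a}{-1}=0$ for every integer $a$; let $D(x)=\sum_{0\le k\le n/2}d_kx^k$. (Only the values $u_j$ with $j\le m$ are used in the claim.) *)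

(* Defs.v *)
(* The complex numbers are R[i] for R : realType; the side
   lengths, radius, etc. are real but are manipulated inside R[i]. *)
From HB Require Import structures.
From mathcomp Require Import all_boot all_order all_algebra.
From mathcomp Require Import reals complex mpoly.

Set Implicit Arguments.
Unset Strict Implicit.
Unset Printing Implicit Defensive.

Import Order.TTheory GRing.Theory Num.Theory.
Local Open Scope ring_scope.
Local Open Scope complex_scope.

(* Vertices are indexed by 'I_n, i.e. 0, .., n-1; ordS is the cyclic successor,
   so that the vertex following v i is v (ordS i). *)
Definition cyclic_polygon (R : realType) (n : nat) (r : R)
    (v : 'I_n -> R[i]) : Prop :=
  [/\ (3 <= n)%N, 0 < r, forall i, `|v i| = r%:C
    & forall i, 0 < `|v (ordS i) - v i| ].

Definition esym (C : comNzRingType) (n k : nat) (x : 'I_n -> C) : C :=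
  (mesym n C k).@[x].

Definition side (R : realType) (n : nat) (v : 'I_n -> R[i]) (i : 'I_n) : R[i] :=
  `|v (ordS i) - v i|.

Definition sigma (R : realType) (n : nat) (v : 'I_n -> R[i]) (k : nat) : R[i] :=
  esym k (fun i => side v i ^+ 2).

Definition vquot (R : realType) (n : nat) (v : 'I_n -> R[i])
    (i : 'I_n) : R[i] :=
  v (ordS i) / v i.

Definition tau (R : realType) (n : nat) (v : 'I_n -> R[i]) (k : nat) : R[i] :=
  esym k (vquot v).

(* For even n the product is real and nonzero: the conjugate of 1 - q is
   - (1 - q) / q when |q| = 1, and the quotients multiply to 1.
   On R[i] the order x < y means that y - x is a positive real, hence Num.sg
   restricted to the reals is the usual sign. *)
Definition crossing_parity (R : realType) (n : nat) (v : 'I_n -> R[i]) : R[i] :=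
  if odd n then 0 else Num.sg (\prod_(i < n) (1 - vquot v i)).

(* The upper index n - 1 - 2k + i is negative only if n = 2k and i = 0; the
   truncated subtraction then yields 'C(0, 0) = 1, as it should. *)
Definition dcoef (R : realType) (n : nat) (v : 'I_n -> R[i]) (k : nat) : R[i] :=
  \sum_(0 <= i < k.+1)
    (-1) ^+ i * 'C(n + i - (1 + 2 * k), i)%:R
      * (tau v (k - i) - tau v (n - k + i)).

Definition ecoef (R : realType) (n : nat) (v : 'I_n -> R[i]) (k : nat) : R[i] :=
  \sum_(0 <= i < k.+1)
    (-1) ^+ i
      * ('C(n - 2 * k + i, i)
         + (if i is i'.+1 then 'C(n - 2 * k + i - 1, i') else 0))%N%:R
      * (tau v (k - i) + tau v (n - k + i)).

Definition Dpoly (R : realType) (n : nat) (v : 'I_n -> R[i]) : {poly R[i]} :=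
  \poly_(k < (n %/ 2).+1) dcoef v k.

Definition ucoef (R : realType) (n : nat) (r : R) (v : 'I_n -> R[i])
    (j : nat) : R[i] :=
  r%:C ^+ (2 * j)
    * \sum_(1 <= i < j) (4^-1 * dcoef v i - dcoef v i.-1) * dcoef v (j - i).

Definition half_deg (n : nat) : nat := (n.-1 %/ 2)%N.

(* In the quadratic sum the truncated j - i is 0 as soon as j <= i, so only
   terms t i with 1 <= i < j occur. *)
Definition trec_rhs (R : realType) (n : nat) (r : R) (v : 'I_n -> R[i])
    (t : nat -> R[i]) (j : nat) : R[i] :=
  let m := half_deg n in
  (-1) ^+ j.+1 * sigma v j
  + \sum_(1 <= i < m.+1 | (1 <= j - i <= m)%N) t i * t (j - i)%N / 4
  + (if (j <= m)%N then - ucoef r v j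
     else crossing_parity v * (-1) ^+ m * t (j - m - 1)%N * sqrtC (sigma v n)).

Definition is_tseq (R : realType) (n : nat) (r : R) (v : 'I_n -> R[i])
    (t : nat -> R[i]) : Prop :=
  t 0%N = -2 /\
  forall j : nat, (1 <= j <= (2 * half_deg n).+1)%N ->
    t j = trec_rhs r v t j.

(* Since half_deg n >= 1 when n >= 3, the exponents j - 2 in the second sum
   are never truncated. *)
Definition Ppoly (R : realType) (n : nat) (r : R) (v : 'I_n -> R[i])
    (t : nat -> R[i]) : {poly R[i]} :=
  let m := half_deg n in
  \sum_(2 <= j < m.+1) ucoef r v j *: 'X^(j - 2)
  + \sum_(m.+1 <= j < (2 * m).+2) t j *: 'X^(j - 2).

(* D(r^2 z).  Its quotient by 'X is exact (Dscaled_divX), so that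
   Dscaled r v %/ 'X is the polynomial z^-1 D(r^2 z). *)
Definition Dscaled (R : realType) (n : nat) (r : R) (v : 'I_n -> R[i]) :
    {poly R[i]} :=
  Dpoly v \Po ((r%:C ^+ 2) *: 'X).

Lemma trec_rhs_ext (R : realType) (n : nat) (r : R) (v : 'I_n -> R[i])
    (t t' : nat -> R[i]) (j : nat) :
  (forall i, (i < j)%N -> t i = t' i) -> trec_rhs r v t j = trec_rhs r v t' j.
Proof.
move=> tt'; rewrite /trec_rhs; congr (_ + _ + _).
  rewrite big_nat_cond [RHS]big_nat_cond; apply: eq_bigr => i.
  case/andP=> /andP[i1 _] /andP[ji _].
  have ij : (i < j)%N by rewrite -subn_gt0.
  by rewrite !tt' // ltn_subrL i1 (leq_trans _ ij).
case: ifPn => // jm; rewrite tt' //.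
by rewrite -subnDA addn1 ltn_subrL /=; case: j jm {tt'}.
Qed.

Lemma is_tseq_exists (R : realType) (n : nat) (r : R) (v : 'I_n -> R[i]) :
  exists t : nat -> R[i], is_tseq r v t.
Proof.
pose T := fix T (k : nat) : nat -> R[i] :=
  if k is k'.+1 then
    fun j => if (j <= k')%N then T k' j else trec_rhs r v (T k') j
  else fun _ => -2.
have TE k l i : (i <= k)%N -> T (k + l)%N i = T k i.
  move=> ik; elim: l => [|l IH]; first by rewrite addn0.
  by rewrite addnS /= (leq_trans ik (leq_addr _ _)).
exists (fun j => T j j); split=> // -[//|j] _ /=; rewrite ltnn.
apply: trec_rhs_ext => i ij.
by rewrite -(subnKC (_ : (i <= j)%N)) // TE.
Qed.

Lemma dcoef0 (R : realType) (n : nat) (r : R) (v : 'I_n -> R[i]) :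
  cyclic_polygon r v -> dcoef v 0 = 0.
Proof.
case=> n3 r0 vr _.
have v0 i : v i != 0 by rewrite -normr_gt0 vr ltcR.
rewrite /dcoef big_nat1 !subn0 !addn0 /tau /esym.
suff -> : (mesym n R[i] n).@[vquot v] = 1.
  by rewrite mesym0E meval1 subrr mulr0.
rewrite mesymnnE rmorph_prod /=.
under eq_bigr do rewrite mevalXU.
rewrite prodf_div [X in _ / X](reindex_inj (@ordS_inj n)) divff //.
by apply/prodf_neq0 => i _.
Qed.

Lemma Dscaled_divX (R : realType) (n : nat) (r : R) (v : 'I_n -> R[i]) :
  cyclic_polygon r v -> 'X * (Dscaled r v %/ 'X) = Dscaled r v.
Proof.
move=> /dcoef0 d0; rewrite mulrC divpK // -['X]subr0 -polyC0 dvdp_XsubCl.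
by rewrite rootE horner_comp !hornerE horner_coef0 coef_poly d0.
Qed.

(* Main.v *)
(* Write q_i for the vertex quotients and, for a + b = 1, put y = a b. By
   Binet's formulas for Fibonacci and Lucas polynomials,
     (a - b) D(y) = Q - Q'  and  E(y) = Q + Q',
   where E is the generating polynomial of the e_k,
   Q = prod_i (a + b q_i) and Q' = prod_i (b + a q_i).
   Since (a - b)^2 = 1 - 4 y and a_i^2 = r^2 (2 - q_i - 1/q_i), multiplying
   gives
     E(y)^2 - (1 - 4 y) D(y)^2 = 4 Q Q' = 4 sum_j (-1)^j sigma_j (y / r^2)^j.
   With y = r^2 z, the coefficient of z^j says that - e_j r^(2j) satisfies the
   recursion of t_j for j <= m, because u_j is the coefficient of z^j in
   W(z) = (1/4 - r^2 z) D(r^2 z)^2; for j > m, where only products e_i e_(j-i)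
   remain, it says that t_j is the coefficient of z^j in W(z). For even n one
   more coefficient e_(n/2) = 2 (-1)^(n/2) prod_i (1 - q_i) occurs, a multiple
   of sqrt(sigma_n) whose sign is given by the crossing parity. *)
Require Import Defs.
From HB Require Import structures.
From mathcomp Require Import all_boot all_order all_algebra.
From mathcomp Require Import reals complex mpoly.
From mathcomp Require Import zify ring.

Set Implicit Arguments.
Unset Strict Implicit.
Unset Printing Implicit Defensive.

Import Order.TTheory GRing.Theory Num.Theory.
Local Open Scope ring_scope.
Local Open Scope complex_scope.

(** * Expansion of products and rearrangement of sums *)

Lemma prod_esym (C : comNzRingType) n (a b : C) (x : 'I_n -> C) :
  \prod_i (a + b * x i)
  = \sum_(k < n.+1) Defs.esym k x * (a ^+ (n - k) * b ^+ k).
Proof.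
have cardP (J : {set 'I_n}) : (#|J| < n.+1)%N.
  by rewrite ltnS (leq_trans (max_card _)) ?card_ord.
under eq_bigr do rewrite addrC.
rewrite bigA_distr /=.
rewrite (partition_big (fun J => Ordinal (cardP J)) xpredT) //=.
apply: eq_bigr => k _; rewrite /Defs.esym rmorph_sum mulr_suml /=.
apply: eq_big => [J|J /eqP/(congr1 val) /= Jk].
  by rewrite -val_eqE.
rewrite rmorph_prod /= [in RHS](eq_bigr x) => [|i _]; last by rewrite mevalXU.
rewrite (bigID (mem J)) /= (eq_bigr (fun i => b * x i)) => [|i /= ->//].
rewrite [X in _ * X](eq_bigr (fun=> a)) => [|i /= /negbTE->//].
rewrite big_split /= !prodr_const Jk.
rewrite (_ : #|_| = n - k)%N; first by ring.
by have := cardC (mem J); rewrite card_ord -Jk => /(canRL (addKn _)).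
Qed.

(** Pairs [j] with [n - j], as tau is paired in [dcoef] and [ecoef]; for even [n] the middle index
    has no partner and counts once. *)
Lemma fold_sum (V : zmodType) (n : nat) (f : nat -> V) :
  \sum_(j < n.+1) f j
  = \sum_(j < (n %/ 2).+1) (if j == (n - j)%N :> nat then f j
                            else f j + f (n - j)%N).
Proof.
rewrite (bigID (fun j : 'I_n.+1 => j < (n %/ 2).+1)%N) /=.
rewrite [X in _ + X](reindex_inj rev_ord_inj) /=.
rewrite (big_ord_widen n.+1 (fun j => if j == (n - j)%N then f j
           else f j + f (n - j)%N)); last by lia.
rewrite [X in _ + X]big_mkcond [X in _ + X](bigID
  (fun j : 'I_n.+1 => j < (n %/ 2).+1)%N) /= [X in _ + (_ + X)]big1 ?addr0.
  rewrite -big_split /=; apply: eq_bigr => j jn; rewrite !subSS.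
  by case: ifP; case: ifP; rewrite ?addr0 //; lia.
by move=> j jn; rewrite subSS; case: ifP => //; lia.
Qed.

(** Exchange of summation along [k = i + j]; it gathers all terms with the same index [j] of tau. *)
Lemma sum_triangle (C : comNzRingType) (h : nat) (G : nat -> nat -> C) (y : C) :
  \sum_(k < h.+1) (\sum_(i < k.+1) G i (k - i)%N) * y ^+ k
  = \sum_(j < h.+1) y ^+ j * \sum_(i < (h - j).+1) G i j * y ^+ i.
Proof.
elim: h => [|h IH].
  by rewrite !(subnn, big_ord1, expr0, mulr1, mul1r).
rewrite big_ord_recr IH [RHS]big_ord_recr /= subnn big_ord1 expr0 mulr1.
under [in RHS]eq_bigr => j _.
  rewrite subSn ?leq_ord // big_ord_recr /= mulrDr.
  rewrite [y ^+ j * (_ * _)]mulrCA -exprD addnS subnKC ?leq_ord //.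
  over.
rewrite big_split /= -addrA; congr (_ + _).
rewrite (reindex_inj rev_ord_inj) /=. rewrite big_ord_recr mulrDl mulr_suml /=.
rewrite !subSS subnn subn0 [y ^+ _ * _]mulrC; congr (_ + _).
apply: eq_bigr => j _. by rewrite subSS subKn ?subSn ?leq_ord // leqW ?leq_ord.
Qed.

(** * Fibonacci and Lucas polynomials *)

(** The Fibonacci polynomial that expresses [(a^(M+1) - b^(M+1)) / (a - b)] through [y = a b] when
    [a + b = 1]. Terms with [2 i > M] are zero. *)
Definition fibsum (C : comNzRingType) (y : C) (M : nat) : C :=
  \sum_(i < M.+1) (-1) ^+ i * 'C(M - i, i)%:R * y ^+ i.

Lemma fibsum_trunc (C : comNzRingType) (y : C) (M h : nat) :
  (M <= h.*2.+1)%N -> (h <= M)%N ->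
  \sum_(i < h.+1) (-1) ^+ i * 'C(M - i, i)%:R * y ^+ i = fibsum y M.
Proof.
move=> Mh hM; rewrite /fibsum.
rewrite (big_ord_widen M.+1 (fun i => (-1) ^+ i * 'C(M - i, i)%:R * y ^+ i)) //.
rewrite big_mkcond; apply: eq_bigr => i _; case: ifP => // ih.
by rewrite bin_small ?mulr0 ?mul0r //; lia.
Qed.

Lemma fibsumSS (C : comNzRingType) (y : C) (M : nat) :
  fibsum y M.+2 = fibsum y M.+1 - y * fibsum y M.
Proof.
rewrite /fibsum big_ord_recr /= subnn mulr0 mul0r addr0.
rewrite big_ord_recl [X in _ = X - _]big_ord_recl /= !bin0 -addrA.
congr (_ + _); rewrite mulr_sumr -sumrB; apply: eq_bigr => i _ /=.
rewrite /bump /= !add1n !subSS subSn ?leq_ord // binS natrD !exprS.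
ring.
Qed.

(** The two-step recurrence with its coefficient 1 written as [a + b]. Combined with the version
    where [a] and [b] are swapped, it gives both Binet formulas without division by [a - b]. *)
Lemma fibsumS (C : comNzRingType) (a b : C) (M : nat) : a + b = 1 ->
  fibsum (a * b) M.+1 = a * fibsum (a * b) M + b ^+ M.+1.
Proof.
move=> ab1; elim: M => [|M IH].
  rewrite /fibsum !big_ord_recl !big_ord0 /= !bin0.
  by rewrite (_ : 'C(_, _) = 0%N) //
    !(expr0, expr1, mulr1, mulr0, mul0r, addr0).
transitivity ((a + b) * fibsum (a * b) M.+1 - a * b * fibsum (a * b) M).
  by rewrite ab1 mul1r fibsumSS.
by rewrite mulrDl -addrA; congr (_ + _); rewrite IH [b ^+ M.+2]exprS; ring.
Qed.

Lemma fibsum_binet (C : comNzRingType) (a b : C) (M : nat) : a + b = 1 ->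
  (a - b) * fibsum (a * b) M = a ^+ M.+1 - b ^+ M.+1.
Proof.
move=> ab1; have := fibsumS M ab1.
have ba1 : b + a = 1 by rewrite addrC.
rewrite [a * b]mulrC (fibsumS M ba1) [b * a]mulrC mulrBl.
move/(canLR (addrK _)) => <-.
by ring.
Qed.

Lemma lucas_binet (C : comNzRingType) (a b : C) (N : nat) :
  (0 < N)%N -> a + b = 1 ->
  \sum_(i < (N %/ 2).+1) (-1) ^+ i
     * ('C(N - i, i) + (if i : nat is i'.+1 then 'C(N - i - 1, i') else 0))%N%:R
     * (a * b) ^+ i
  = a ^+ N + b ^+ N.
Proof.
move=> + ab1; case: N => [//|[_|N _]].
  by rewrite big_ord_recl big_ord0 /= bin0 !mul1r !addr0.
have ba1 : b + a = 1 by rewrite addrC.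
(* Two first-order steps, one with [a] and one with [b], lower the index by two. *)
have -> : a ^+ N.+2 + b ^+ N.+2
    = fibsum (a * b) N.+2 - a * b * fibsum (a * b) N.
  have := fibsumS N ba1; rewrite [b * a]mulrC (fibsumS N.+1 ab1) => ->.
  by rewrite exprS; ring.
rewrite -(@fibsum_trunc _ _ N.+2 (N.+2 %/ 2)); [|lia|lia].
rewrite -(@fibsum_trunc _ _ N (N %/ 2)); [|lia|lia].
have -> : (N.+2 %/ 2 = (N %/ 2).+1)%N by lia.
rewrite big_ord_recl [in RHS]big_ord_recl /= !bin0 addn0 -addrA; congr (_ + _).
rewrite mulr_sumr -sumrB; apply: eq_bigr => i _ /=.
rewrite /bump /= !add1n !subSS natrD !exprS.
have -> : (N.+1 - i - 1 = N - i)%N by lia.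
ring.
Qed.

(** * Equality of polynomials by evaluation; coefficients of squares *)

(** In characteristic 0 the naturals below the size of a nonzero [p - q] would be too many roots.
    Evaluation allows [a] and [b] to be chosen separately at each point. *)
Lemma eq_poly_horner (F : numDomainType) (p q : {poly F}) :
  (forall x, p.[x] = q.[x]) -> p = q.
Proof.
move=> pq; apply/eqP; rewrite -subr_eq0; apply/negPn/negP=> nz.
pose s : seq F := [seq i%:R | i <- iota 0 (size (p - q))].
have := @max_poly_roots _ (p - q) s nz; rewrite size_map size_iota ltnn.
have -> : all (root (p - q)) s.
  by apply/allP=> x _; rewrite rootE hornerD hornerN pq subrr.
rewrite map_inj_uniq ?iota_uniq; last exact: mulrIn (oner_neq0 _).
by move/(_ isT isT).
Qed.

Lemma sqr_coef_low (C : comNzRingType) (p : {poly C}) j : (1 <= j)%N ->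
  (p ^+ 2)`_j = 2 * p`_0 * p`_j + \sum_(1 <= i < j) p`_i * p`_(j - i).
Proof.
case: j => // j _; rewrite expr2 coefM big_ord_recl big_ord_recr /= subnn subn0.
rewrite big_add1 big_mkord; ring.
Qed.

(** The index [k + 1] occurs in two distinct terms since [j < 2 (k + 1)]; in any other nonzero term
    both indices lie between 1 and [k]. *)
Lemma sqr_coef_high (C : comNzRingType) (p : {poly C}) (k j : nat) :
  (forall i, (k.+1 < i)%N -> p`_i = 0) -> (k < j <= (2 * k).+1)%N ->
  (p ^+ 2)`_j = 2 * p`_k.+1 * p`_(j - k.+1)
     + \sum_(1 <= i < k.+1 | (1 <= j - i <= k)%N) p`_i * p`_(j - i).
Proof.
move=> p0 /andP[kj j2k]; rewrite expr2 coefM.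
have jS : (j - k.+1 < j.+1)%N by lia.
have kS : (k.+1 < j.+1)%N by lia.
rewrite (bigD1 (Ordinal kS)) //= (bigD1 (Ordinal jS)) /=; last first.
  by rewrite -val_eqE /=; lia.
rewrite subKn // addrA; congr (_ + _); first by ring.
rewrite (big_nat_widenl 1 0) // (big_nat_widen 0 k.+1 j.+1); last by lia.
rewrite big_mkord big_mkcond [RHS]big_mkcond /=; apply: eq_bigr => i _.
rewrite -!val_eqE /=; have := ltn_ord i; move: (nat_of_ord i) => {}i ij.
case: ifPn => c1; case: ifPn => c2 //; last by lia.
have [ki|ik] := ltnP k.+1 i; first by rewrite p0 ?mul0r.
by rewrite [p`_(j - i)]p0 ?mulr0 //; lia.
Qed.

(** * Generating polynomials of the [d_k] and [e_k] *)

Section Binet.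
Variables (R : realType) (n : nat) (v : 'I_n -> R[i]) (a b : R[i]).
Hypothesis ab1 : a + b = 1.

(** Collected by [j = k - i], the difference of tau at [j] and [n - j] is multiplied by [(a b)^j]
    times the Fibonacci polynomial with [M = n - 1 - 2 j]. Binet's formula turns this into the terms
    [j] and [n - j] of the expanded products. *)
Lemma dcoef_binet :
  (a - b) * \sum_(k < (n %/ 2).+1) dcoef v k * (a * b) ^+ k
  = \prod_i (a + b * vquot v i) - \prod_i (b + a * vquot v i).
Proof.
pose G i j : R[i] := (-1) ^+ i * 'C(n - (1 + 2 * j) - i, i)%:R
   * (tau v j - tau v (n - j)).
rewrite (eq_bigr (fun k : 'I_ _ =>
    (\sum_(i < k.+1) G i (k - i)%N) * (a * b) ^+ k)) => [|k _]; last first.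
  congr (_ * _); rewrite /dcoef big_mkord; apply: eq_bigr => i _.
  have ik := leq_ord i; have kn := leq_ord k.
  rewrite /G; congr (_ * _%:R * (_ - tau v _)); last by lia.
  by congr binomial; lia.
rewrite sum_triangle !prod_esym -sumrB mulr_sumr.
rewrite (fold_sum _ (fun k => tau v k * (a ^+ (n - k) * b ^+ k)
  - tau v k * (b ^+ (n - k) * a ^+ k))).
apply: eq_bigr => j _; have jn := leq_ord j.
rewrite /G; under eq_bigr do rewrite mulrAC.
(* For [n = 2 j] the truncated [M] is harmless: the middle term vanishes on both sides. *)
rewrite -mulr_suml; case: eqP => [<-|/eqP jnj].
  by rewrite [b ^+ _ * _]mulrC !subrr !mulr0.
have j2n : (2 * j < n)%N by lia.
rewrite fibsum_trunc; [|lia|lia].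
rewrite subKn; last by lia.
transitivity ((a * b) ^+ j * (tau v j - tau v (n - j))
   * ((a - b) * fibsum (a * b) (n - (1 + 2 * j)))); first by ring.
rewrite fibsum_binet // (_ : (n - (1 + 2 * j)).+1 = n - j - j)%N; last by lia.
have split_exp x : x ^+ (n - j) = x ^+ (n - j - j) * x ^+ j :> R[i].
  by rewrite -exprD; congr (x ^+ _); lia.
by rewrite !split_exp exprMn; ring.
Qed.

Lemma ecoef_binet : (0 < n)%N ->
  \sum_(k < (n %/ 2).+1) ecoef v k * (a * b) ^+ k
  = \prod_i (a + b * vquot v i) + \prod_i (b + a * vquot v i).
Proof.
move=> n0.
pose G i j : R[i] := (-1) ^+ i * ('C(n - 2 * j - i, i) +
    (if i is i'.+1 then 'C(n - 2 * j - i - 1, i') else 0))%N%:R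
   * (tau v j + tau v (n - j)).
rewrite (eq_bigr (fun k : 'I_ _ =>
    (\sum_(i < k.+1) G i (k - i)%N) * (a * b) ^+ k)) => [|k _]; last first.
  congr (_ * _); rewrite /ecoef big_mkord; apply: eq_bigr => i _.
  have ik := leq_ord i; have kn := leq_ord k.
  have -> : (n - 2 * k + i = n - 2 * (k - i) - i)%N by lia.
  by have -> : (n - k + i = n - (k - i))%N by lia.
rewrite sum_triangle !prod_esym -big_split /=.
rewrite (fold_sum _ (fun k => tau v k * (a ^+ (n - k) * b ^+ k)
  + tau v k * (b ^+ (n - k) * a ^+ k))).
apply: eq_bigr => j _; have jn := leq_ord j.
rewrite /G; under eq_bigr do rewrite mulrAC.
(* For [n = 2 j] the Lucas sum is 1 instead of [a^0 + b^0 = 2], which is right because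
   [tau_j + tau_(n-j)] is already [2 tau_j]. *)
rewrite -mulr_suml; case: eqP => [jnj|/eqP jnj].
  have -> : (n %/ 2 - j = 0)%N by lia.
  by rewrite big_ord1 /= bin0 -jnj exprMn; ring.
have -> : (n %/ 2 - j = (n - 2 * j) %/ 2)%N by lia.
rewrite (lucas_binet _ ab1) ?subKn; [|lia|lia].
rewrite (_ : n - 2 * j = n - j - j)%N; last by lia.
have split_exp x : x ^+ (n - j) = x ^+ (n - j - j) * x ^+ j :> R[i].
  by rewrite -exprD; congr (x ^+ _); lia.
by rewrite !split_exp exprMn; ring.
Qed.

End Binet.

(** * Vertex quotients and side lengths *)

Section Polygon.
Variables (R : realType) (n : nat) (r : R) (v : 'I_n -> R[i]).
Hypothesis hv : cyclic_polygon r v.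

Let rho : R[i] := r%:C.

Lemma radius_gt0 : 0 < rho.
Proof. by case: hv => _ r0 _ _; rewrite ltcR. Qed.

Lemma vertex_neq0 i : v i != 0.
Proof. by case: hv => _ _ vr _; rewrite -normr_gt0 vr radius_gt0. Qed.

Lemma vquot_neq0 i : vquot v i != 0.
Proof. by rewrite mulf_neq0 ?invr_neq0 ?vertex_neq0. Qed.

Lemma conjC_vquot i : (vquot v i)^*%R = (vquot v i)^-1.
Proof.
case: hv => _ _ vr _; rewrite invC_norm /vquot normf_div !vr divff.
  by rewrite expr1n invr1 mul1r.
by rewrite gt_eqF // radius_gt0.
Qed.

Lemma prod_vquot : \prod_i vquot v i = 1.
Proof.
rewrite prodf_div [X in _ / X](reindex_inj (@ordS_inj n)) divff //.
by apply/prodf_neq0 => i _; apply: vertex_neq0.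
Qed.

Lemma sideE i : side v i = rho * `|1 - vquot v i|.
Proof.
case: hv => _ _ vr _; rewrite /side /rho -(vr i) -normrM mulrBr mulr1 distrC.
by rewrite mulrC divfK ?vertex_neq0.
Qed.

Lemma side_sqE i :
  side v i ^+ 2 = rho ^+ 2 * (2 - vquot v i - (vquot v i)^-1).
Proof.
rewrite sideE exprMn normCK rmorphB rmorph1 /= conjC_vquot; congr (_ * _).
by field; apply: vquot_neq0.
Qed.

Lemma tau0 : tau v 0 = 1.
Proof. by rewrite /tau /Defs.esym mesym0E meval1. Qed.

Lemma ecoef0 : ecoef v 0 = 2.
Proof.
have := dcoef0 hv; rewrite /dcoef /ecoef !big_nat1 !subn0 !addn0 !bin0.
by rewrite expr0 !mul1r => /eqP; rewrite subr_eq0 => /eqP <-; rewrite tau0.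
Qed.

Lemma sigmanE : sqrtC (sigma v n) = rho ^+ n * `|\prod_i (1 - vquot v i)|.
Proof.
rewrite /sigma /Defs.esym mesymnnE rmorph_prod /=.
under eq_bigr do rewrite mevalXU.
rewrite prodrXl sqrCK; last by apply: prodr_ge0 => i _; apply: normr_ge0.
under eq_bigr do rewrite sideE.
by rewrite big_split /= prodr_const card_ord normr_prod.
Qed.

Lemma prod_1Bvquot_real : ~~ odd n -> \prod_i (1 - vquot v i) \is Num.real.
Proof.
move=> evn; apply/CrealP; rewrite rmorph_prod /=.
under eq_bigr => i _.
  rewrite rmorphB rmorph1 /= conjC_vquot.
  rewrite (_ : 1 - _ = - 1 * ((1 - vquot v i) / vquot v i)); last first.
    by field; apply: vquot_neq0.
  over.
rewrite big_split /= prodr_const card_ord -signr_odd (negbTE evn) mul1r.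
by rewrite prodf_div prod_vquot divr1.
Qed.

(** * The quadratic identity and its coefficients *)

Definition Escaled : {poly R[i]} :=
  \poly_(k < (n %/ 2).+1) (ecoef v k * rho ^+ (2 * k)).

Lemma DscaledE :
  Dscaled r v = \poly_(k < (n %/ 2).+1) (dcoef v k * rho ^+ (2 * k)).
Proof.
apply: eq_poly_horner => x; rewrite horner_comp !horner_poly !hornerE.
by apply: eq_bigr => k _; rewrite exprMn -exprM mulrA.
Qed.

Lemma coef_Dscaled k : (k <= n %/ 2)%N ->
  (Dscaled r v)`_k = dcoef v k * rho ^+ (2 * k).
Proof. by move=> kn; rewrite DscaledE coef_poly ltnS kn. Qed.

Lemma quadratic_identity :
  Escaled ^+ 2 = 4 *: (\poly_(k < n.+1) ((-1) ^+ k * sigma v k)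
    + ((4^-1)%:P - rho ^+ 2 *: 'X) * Dscaled r v ^+ 2).
Proof.
apply: eq_poly_horner => x.
have [n3 _ _ _] := hv.
(* [a] and [b] are the roots of [T^2 - T + r^2 x]. *)
pose s := sqrtC (1 - 4 * (rho ^+ 2 * x)).
pose a := (1 + s) / 2; pose b := (1 - s) / 2.
have ab1 : a + b = 1 by rewrite /a /b; field.
have abx : a * b = rho ^+ 2 * x.
  transitivity ((1 - s ^+ 2) / 4); first by rewrite /a /b; field.
  by rewrite sqrtCK; field.
have EE : Escaled.[x]
    = \prod_i (a + b * vquot v i) + \prod_i (b + a * vquot v i).
  rewrite -ecoef_binet //; last by lia.
  rewrite horner_poly; apply: eq_bigr => k _.
  by rewrite abx exprMn -exprM mulrA.
have DD : (a - b) * (Dscaled r v).[x]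
    = \prod_i (a + b * vquot v i) - \prod_i (b + a * vquot v i).
  by rewrite -dcoef_binet // abx horner_comp horner_poly !hornerE.
have SS : (\poly_(k < n.+1) ((-1) ^+ k * sigma v k)).[x]
    = \prod_i (a + b * vquot v i) * \prod_i (b + a * vquot v i).
  transitivity (\prod_i (1 + - x * side v i ^+ 2)).
    rewrite prod_esym horner_poly; apply: eq_bigr => k _.
    by rewrite expr1n mul1r [(- x) ^+ k]exprNn mulrCA mulrA.
  (* Division by the product of the [q_i], which is 1, gives one factor per side: [(a + b q) (b + a
     q) / q = 1 - a b (2 - q - 1/q)]. *)
  rewrite -big_split -[RHS](mulfK (oner_neq0 _)) mulr1.
  rewrite -[X in _ / X]prod_vquot -prodf_div /=.
  apply: eq_bigr => i _; rewrite side_sqE.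
  rewrite (_ : - x * (_ * _) = - (a * b) * (2 - vquot v i - (vquot v i)^-1)).
    have -> : a = 1 - b by rewrite -ab1 addrK.
    by field; apply: vquot_neq0.
  by rewrite abx; ring.
have s2 : 4^-1 - rho ^+ 2 * x = (a - b) ^+ 2 / 4.
  transitivity (s ^+ 2 / 4); first by rewrite sqrtCK; field.
  by rewrite /a /b; field.
rewrite !hornerE /= EE SS s2.
clearbody a b; rewrite [X in 4 * (_ + X)]
  (_ : _ = ((a - b) * (Dscaled r v).[x]) ^+ 2 / 4).
  by rewrite DD; field.
by field.
Qed.

(** In the convolution of [(1/4 - r^2 z) D(r^2 z)] with [D(r^2 z)] both end terms vanish by
    [d_0 = 0]. The others only involve indices below [j], hence at most [n %/ 2], where [Dscaled] is
    not cut off. *)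
Lemma coef_ucoef j : (j <= (n %/ 2).+1)%N ->
  (((4^-1)%:P - rho ^+ 2 *: 'X) * Dscaled r v ^+ 2)`_j = ucoef r v j.
Proof.
move=> jn; rewrite [Dscaled r v ^+ 2]expr2 mulrA mulrBl -scalerAl.
rewrite mul_polyC coefM /ucoef.
case: j jn => [|j] jn.
  rewrite big_ord1 !(coefB, coefZ, coefXM) /= coef_Dscaled // (dcoef0 hv).
  by rewrite big_geq // !(mulr0, mul0r).
rewrite big_ord_recl big_ord_recr /= subnn (coef_Dscaled (leq0n _)) (dcoef0 hv).
rewrite !mul0r mulr0 addr0.
rewrite !(coefB, coefZ, coefXM) /= coef_Dscaled // (dcoef0 hv).
rewrite !(mul0r, mulr0, subr0, oppr0, add0r).
rewrite big_add1 big_mkord mulr_sumr.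
apply: eq_bigr => i _; rewrite /bump /= add1n !(coefB, coefZ, coefXM) /=.
have ij := ltn_ord i.
rewrite !coef_Dscaled; [|lia..].
rewrite subSS mulrACA.
have -> : rho ^+ (2 * j.+1) = rho ^+ (2 * i.+1) * rho ^+ (2 * (j - i)).
  by rewrite -exprD; congr (_ ^+ _); lia.
by rewrite mulnS exprD; ring.
Qed.

(** At [k = n / 2] the sum of binomials is 1 for [i = 0], where [tau_k] appears twice, and 2 for
    [i > 0]. So every tau enters with weight 2 and alternating sign, as in the expanded product. *)
Lemma ecoef_half : ~~ odd n ->
  ecoef v (n %/ 2) = 2 * (-1) ^+ (n %/ 2) * \prod_i (1 - vquot v i).
Proof.
move=> evn; have n2 : (n = n %/ 2 + n %/ 2)%N by lia.
transitivity (2 * (-1) ^+ (n %/ 2) * \prod_i (1 + -1 * vquot v i)); last first.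
  by congr (_ * _); apply: eq_bigr => i _; rewrite mulN1r.
rewrite prod_esym (fold_sum _ (fun k => tau v k * (1 ^+ (n - k) * (-1) ^+ k))).
rewrite mulr_sumr [RHS](reindex_inj rev_ord_inj) /ecoef big_mkord /=.
apply: eq_bigr => i _; have := leq_ord i; rewrite subSS.
set h := (n %/ 2)%N => ih.
have -> : (n - (h - i) = h + i)%N by rewrite /h in ih *; lia.
rewrite (_ : n - 2 * h = 0)%N; last by rewrite /h; lia.
rewrite (_ : n - h + i = h + i)%N; last by rewrite /h; lia.
have sgn : (-1) ^+ (h - i) = (-1) ^+ h * (-1) ^+ i :> R[i].
  by rewrite -signr_odd oddB // signr_addb !signr_odd.
have hh : (-1) ^+ h * (-1) ^+ h = 1 :> R[i] by rewrite -expr2 sqrr_sign.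
rewrite !expr1n !mul1r sgn exprD add0n binn; case: (nat_of_ord i) => [|k].
  by rewrite subn0 !addn0 eqxx; ring: hh.
have /negbTE-> : (h - k.+1 != h + k.+1)%N by lia.
rewrite subn1 binn.
by ring: hh.
Qed.

Lemma coef_Escaled k : (k <= n %/ 2)%N ->
  Escaled`_k = ecoef v k * rho ^+ (2 * k).
Proof. by move=> kn; rewrite coef_poly ltnS kn. Qed.

Lemma quadratic_coef j : (j <= n)%N ->
  (Escaled ^+ 2)`_j = 4 * ((-1) ^+ j * sigma v j
    + (((4^-1)%:P - rho ^+ 2 *: 'X) * Dscaled r v ^+ 2)`_j).
Proof.
by move=> jn; rewrite quadratic_identity coefZ coefD coef_poly ltnS jn.
Qed.

(** * The recursion of the [t j] *)

Let m := half_deg n.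

(** For even [n], [m + 1 = n / 2] and the real product of the [1 - q_i] is its sign times its
    modulus. For odd [n], [m + 1] exceeds [n %/ 2] and the crossing parity is 0. *)
Lemma coef_Escaled_top :
  Escaled`_m.+1 = - 2 * (crossing_parity v * (-1) ^+ m * sqrtC (sigma v n)).
Proof.
have [n3 _ _ _] := hv.
rewrite /crossing_parity sigmanE; case: ifPn => oddn.
  rewrite !mul0r mulr0 coef_poly ifF // /m /half_deg.
  by lia.
have mS : m.+1 = (n %/ 2)%N by rewrite /m /half_deg; lia.
rewrite coef_Escaled mS // ecoef_half // -mS (_ : 2 * m.+1 = n)%N; last by lia.
rewrite {1}(realEsg (prod_1Bvquot_real oddn)) exprS.
by ring.
Qed.

Variables (t : nat -> R[i]).
Hypothesis ht : is_tseq r v t.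

Lemma tseq_low j : (j <= m)%N -> t j = - Escaled`_j.
Proof.
have [n3 _ _ _] := hv.
have mn : (m <= n %/ 2)%N by rewrite /m /half_deg; lia.
have [t0 tS] := ht.
elim/ltn_ind: j => -[|j] IH jm.
  by rewrite t0 coef_Escaled // ecoef0 mulr1.
have jn : (j.+1 <= n)%N by lia.
rewrite tS; last by rewrite -/m; lia.
(* Since [e_0 = 2], the newest coefficient of [Escaled] occurs with factor 4, and the identity can
   be solved for it. *)
have := quadratic_coef jn; rewrite sqr_coef_low // coef_ucoef; last by lia.
rewrite (coef_Escaled (leq0n _)) ecoef0 mulr1 /trec_rhs -/m jm.
rewrite (_ : \sum_(1 <= i < m.+1 | _) _
    = (\sum_(1 <= i < j.+1) Escaled`_i * Escaled`_(j.+1 - i)) / 4).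
  move/(canRL (addKr _)) => ->; rewrite exprS.
  by move: (_`_j.+1) (ucoef _ _ _) => x y; field.
rewrite mulr_suml [RHS](big_nat_widen 1 j.+1 m.+1); last by lia.
rewrite [LHS]big_nat_cond [RHS]big_nat_cond; apply: eq_big => [i|i c] /=.
  by lia.
by rewrite !IH ?mulrNN //; lia.
Qed.

(** In the square of [Escaled], the two terms with index [m + 1] give 4 times the crossing parity
    term of the recursion, and the rest 4 times its quadratic sum. *)
Lemma tseq_high j : (m < j <= (2 * m).+1)%N ->
  t j = (((4^-1)%:P - rho ^+ 2 *: 'X) * Dscaled r v ^+ 2)`_j.
Proof.
move=> jm; have [n3 _ _ _] := hv; have [t0 tS] := ht.
have jn : (j <= n)%N by move: jm; rewrite /m /half_deg; lia.
have Egt i : (m.+1 < i)%N -> Escaled`_i = 0.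
  rewrite coef_poly; case: ifP => //.
  by rewrite /m /half_deg; lia.
rewrite tS; last by rewrite -/m; lia.
have := quadratic_coef jn; rewrite (sqr_coef_high Egt jm) coef_Escaled_top.
rewrite /trec_rhs -/m ifF; last by lia.
rewrite -subnDA addn1 (@tseq_low (j - m.+1)); last by lia.
rewrite (_ : \sum_(1 <= i < m.+1 | (1 <= j - i <= m)%N) t i * _ / _
    = (\sum_(1 <= i < m.+1 | (1 <= j - i <= m)%N)
         Escaled`_i * Escaled`_(j - i)) / 4).
  move/(canRL (addKr _)) => ->; rewrite exprS.
  by move: (_`_j) => x; field.
rewrite mulr_suml big_nat_cond [RHS]big_nat_cond; apply: eq_bigr => i c.
by rewrite !tseq_low ?mulrNN //; lia.
Qed.

(** * Degrees and the factorization of [P_n] *)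

(** The tau difference vanishes for [i = 0], the binomial [C(i - 1, i)] for [i > 0]. Hence [D] has
    degree at most [m] for even [n] too. *)
Lemma dcoef_half : ~~ odd n -> dcoef v (n %/ 2) = 0.
Proof.
move=> evn; rewrite /dcoef big_mkord big1 // => i _.
case: (posnP i) => [->|i0].
  by rewrite subn0 !addn0 (_ : n - n %/ 2 = n %/ 2)%N ?subrr ?mulr0 //; lia.
by rewrite bin_small ?mulr0 ?mul0r //; lia.
Qed.

Lemma size_Dscaled : (size (Dscaled r v) <= m.+1)%N.
Proof.
apply/leq_sizeP => k mk; rewrite DscaledE coef_poly; case: ifP => // kn.
rewrite (_ : k = n %/ 2)%N ?dcoef_half ?mul0r //;
  by move: mk kn; rewrite /m /half_deg; lia.
Qed.

Lemma PpolyE :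
  Ppoly r v t = ((4^-1)%:P - (r%:C ^+ 2) *: 'X) * (Dscaled r v %/ 'X) ^+ 2.
Proof.
have [n3 _ _ _] := hv.
pose W := (((4^-1)%:P - rho ^+ 2 *: 'X) * Dscaled r v ^+ 2).
have WX : W = 'X^2 * (((4^-1)%:P - rho ^+ 2 *: 'X) * (Dscaled r v %/ 'X) ^+ 2).
  by rewrite /W -{1}(Dscaled_divX hv) exprMn mulrCA.
have sW : (size W <= (2 * m).+2)%N.
  apply: leq_trans (size_polyMleq _ _) _.
  have l2 : (size ((4^-1)%:P - rho ^+ 2 *: 'X : {poly R[i]})%R <= 2)%N.
    rewrite (leq_trans (size_polyD _ _)) // geq_max size_polyN.
    rewrite (leq_trans (size_polyC_leq1 _)) //.
    by rewrite (leq_trans (size_scale_leq _ _)) ?size_polyX.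
  move: l2 size_Dscaled (size_poly_exp_leq (Dscaled r v) 2).
  move: (size _) (size _) (size _) => s1 s2 s3. lia.
(* It suffices to show that [z^2 P_n(z)] is [W], whose degree is at most [2 m + 1], the last index
   of [t] in [P_n]. *)
apply: (@mulfI _ ('X^2)); first by rewrite -size_poly_eq0 size_polyXn.
rewrite -/rho -WX.
have m1 : (1 <= m)%N by rewrite /m /half_deg; lia.
have -> : Ppoly r v t = \sum_(2 <= j < (2 * m).+2) W`_j *: 'X^(j - 2).
  rewrite /Ppoly -/m [RHS](@big_cat_nat _ _ _ m.+1) //=; last by lia.
  congr (_ + _); rewrite [LHS]big_nat_cond [RHS]big_nat_cond;
    apply: eq_bigr => j c.
    by rewrite -coef_ucoef //; move: c; rewrite /m /half_deg; lia.
  by rewrite tseq_high //; lia.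
rewrite [RHS](_ : W = \poly_(j < (2 * m).+2) W`_j); last first.
  apply/polyP => j; rewrite coef_poly; case: ltnP => //.
  by move/(leq_trans sW)/leq_sizeP->.
rewrite poly_def mulr_sumr -(big_mkord xpredT (fun j => W`_j *: 'X^j)).
(* The coefficients of [W] at 0 and 1 vanish because ['X^2] divides [W]. *)
rewrite [RHS](@big_cat_nat _ _ _ 2) //= [X in _ = X + _]big1_seq ?add0r.
  rewrite big_nat_cond [RHS]big_nat_cond; apply: eq_bigr => j c.
  by rewrite -scalerAr -exprD subnKC //; lia.
by move=> j; rewrite mem_index_iota WX coefXnM /= => ->; rewrite scale0r.
Qed.

End Polygon.

Theorem corollary5 (R : realType) (n : nat) (r : R) (v : 'I_n -> R[i])
    (t : nat -> R[i]) (hv : cyclic_polygon r v) (ht : is_tseq r v t) :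
  (forall j : nat, (j <= half_deg n)%N -> t j = - ecoef v j * r%:C ^+ (2 * j))
  /\ Ppoly r v t
     = ((4^-1)%:P - (r%:C ^+ 2) *: 'X) * (Dscaled r v %/ 'X) ^+ 2.
Proof.
split; last exact: PpolyE.
move=> j jm; rewrite (tseq_low hv ht) // coef_Escaled ?mulNr //.
by move: jm; rewrite /half_deg; lia.
Qed.
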